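(* Among target pairs with $b_w=3$, in the inclusions $\mathrm{FWC}\subseteq\mathrm{EC}\subseteq L$ one has $L\ne\mathrm{EC}$ and $L\ne\mathrm{FWC}$; that is, some target pair with $b_w=3$ in $L$ is not in $\mathrm{EC}$, and some target pair with $b_w=3$ in $L$ is not in $\mathrm{FWC}$.
   Context: A target pair $(H_w,H_r)$ consists of strictly increasing concave rational sequences $H_\alpha$ on $\{0,\dots,b_\alpha\}$, $\alpha\in\{w,r\}$, with $H_\alpha(0)=0$ (the zero sequence, $b_\alpha=0$, is allowed). $h_n=H_w(n)-H_w(n-1)$, $\rho_m=H_r(m)-H_r(m-1)$, $\rho_1:=0$ if $b_r=0$; $\bar H_\alpha(k)=H_\alpha(\min\{k,b_\alpha\})$. A positive count $n\le b_\alpha$ is an $\alpha$-vertex if $n=b_\alpha$ or the slopes of $H_\alpha$ immediately before and after $n$ differ; $\mathcal V_\alpha$ is the set of $\alpha$-vertices and $N^*=\sum_{n\in\mathcal V_w}n+\sum_{m\in\mathcal V_r}m$. Dominance means $H_r(k)\le\bar H_w(k)$ for $0\le k\le b_r$. Linear closure $L$: the set of target pairs satisfying dominance and, for all $0\le m\le b_r$: at each $w$-vertex $n$ with $h_n>\rho_1$, $\bar H_w(n-1+m)\ge\frac{n-1}{n}H_w(n)+H_r(m)$ and, if $n\ge3$, $\bar H_w(m+1)\ge\frac1nH_w(n)+H_r(m)$; and at each $w$-vertex $n\ge3$ with $\bar H_r(2)<H_w(n)-(n-2)H_w(1)$, $\bar H_w(m+1)\ge H_r(m)+\min\{H_w(n)/n,(H_w(n)-\rho_1)/(n-1)\}$.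 $\mathrm{EC}$ (exchange closure): the set of target pairs for which dominance holds and there is an admissible witness, consisting of: for each $w$-vertex $n$, an $n$-element labeled set $X_n$ with rational values $x_{n,i}$, a long/short label for each member, and a downward-closed family $\mathcal F_n$ of subsets of $X_n$ containing $\varnothing$ and whose singletons are precisely the short members; for each $r$-vertex $m$, an $m$-element set $Z_m$ with rational values $z_{m,j}$; for each such $(n,m)$, a subset $O_{n,m}\subseteq X_n$ with $O_{n,m}\in\mathcal F_n$ and a map $\pi_{n,m}:O_{n,m}\to Z_m$; such that: (EC1) $0\le x_{n,i}\le H_w(1)$, short values are at most $\rho_1$, $\sum_i x_{n,i}=H_w(n)$; every $S\subseteq X_n$ has total value at most $\bar H_w(|S|)$, and every $S\in\mathcal F_n$ has total value at most $\bar H_r(|S|)$. (EC2) $0\le z_{m,j}\le\rho_1$, $\sum_j z_{m,j}=H_r(m)$, and every $S\subseteq Z_m$ has total value at most $\bar H_r(|S|)$. (EC3) $\pi_{n,m}$ is injective, $O_{n,m}$ contains only short members, and $x_{n,i}=z_{m,\pi_{n,m}(i)}$ for $i\in O_{n,m}$. (EC4) For every $(n,m)$ and every long $i\in X_n$, with $k=|O_{n,m}|$, $\bar H_w(n-1+m-k)\ge H_w(n)-x_{n,i}+H_r(m)-\sum_{i'\in O_{n,m}}z_{m,\pi_{n,m}(i')}$. (EC5) For every $(n,m)$, every two-element subset $\{i,i'\}\subseteq X_n$ with $\{i,i'\}\notin\mathcal F_n$, and every $y\in X_n\setminus(\{i,i'\}\cup O_{n,m})$, $\bar H_w(m+1)\ge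 x_{n,y}+H_r(m)$. If $b_r=0$ the conditions quantifying over $m$ are vacuous. $\mathrm{FWC}$ (full-witness closure): write $G(S)=\sum_{i\in S}a_i$, $d(S)=\sum_{i\in S}d_i$. $\mathrm{FWC}$ is the set of target pairs possessing a full witness, i.e. a ground set $E$ of at most $N^*$ items, nonnegative rational values $a_i$, positive rational sizes $d_i$, rational $0\le R<D$, and subsets $X_n$ ($n\in\mathcal V_w$), $Z_m$ ($m\in\mathcal V_r$) of $E$ with $|X_n|=n$, $G(X_n)=H_w(n)$, $d(X_n)\le D$, $|Z_m|=m$, $G(Z_m)=H_r(m)$, $d(Z_m)\le R$, such that every $S\subseteq E$ with $d(S)\le D$ has $G(S)\le\bar H_w(|S|)$ and every $S\subseteq E$ with $d(S)\le R$ has $G(S)\le\bar H_r(|S|)$. *)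

(* Defs.v *)
From HB Require Import structures.
From mathcomp Require Import all_boot all_order all_algebra.

Set Implicit Arguments.
Unset Strict Implicit.
Unset Printing Implicit Defensive.

Import Order.TTheory GRing.Theory Num.Theory.
Local Open Scope ring_scope.

(* A sequence on {0, ..., top} is a function on nat; its values beyond top are
   junk, and no definition below depends on them. *)
Record target_seq := TargetSeq {
  top : nat;
  seqval :> nat -> rat;
  seqval0 : seqval 0%N = 0;
  seqval_incr : forall k, (k < top)%N -> seqval k < seqval k.+1;
  seqval_concave : forall k, (0 < k < top)%N ->
    seqval k.+1 - seqval k <= seqval k - seqval k.-1
}.

Record target_pair := TargetPair { Hw : target_seq; Hr : target_seq }.

(* The slope immediately before n; meaningful for 0 < n <= top H. *)
Definition slope (H : target_seq) (n : nat) : rat := H n - H n.-1.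

Definition rho1 (P : target_pair) : rat :=
  if top (Hr P) == 0%N then 0 else slope (Hr P) 1.

Definition Hbar (H : target_seq) (k : nat) : rat := H (minn k (top H)).

Definition vertex (H : target_seq) (n : nat) : bool :=
  (0 < n <= top H)%N && ((n == top H) || (slope H n != slope H n.+1)).

Definition Nstar (P : target_pair) : nat :=
  (\sum_(0 <= n < (top (Hw P)).+1 | vertex (Hw P) n) n +
   \sum_(0 <= m < (top (Hr P)).+1 | vertex (Hr P) m) m)%N.

Definition dominance (P : target_pair) : Prop :=
  forall k, (k <= top (Hr P))%N -> Hr P k <= Hbar (Hw P) k.

Definition linear_closure (P : target_pair) : Prop :=
  dominance P /\
  forall m, (m <= top (Hr P))%N ->
    [/\ forall n, vertex (Hw P) n -> rho1 P < slope (Hw P) n ->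
          Hbar (Hw P) (n.-1 + m) >= n.-1%:R / n%:R * Hw P n + Hr P m,
        forall n, vertex (Hw P) n -> rho1 P < slope (Hw P) n -> (3 <= n)%N ->
          Hbar (Hw P) m.+1 >= n%:R^-1 * Hw P n + Hr P m
      & forall n, vertex (Hw P) n -> (3 <= n)%N ->
          Hbar (Hr P) 2 < Hw P n - (n - 2)%:R * Hw P 1%N ->
          Hbar (Hw P) m.+1 >=
            Hr P m + Num.min (Hw P n / n%:R) ((Hw P n - rho1 P) / n.-1%:R)].

(* The data are given for all n and m, but only those at vertices are
   constrained. The map wpi n m has domain O_{n,m} itself, so that
   the type is inhabited also at the irrelevant indices with m = 0. *)
Record exchange_witness := ExchangeWitness {
  wx : forall n, 'I_n -> rat;
  wshort : forall n, 'I_n -> bool;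
  wF : forall n, {set {set 'I_n}};
  wz : forall m, 'I_m -> rat;
  wO : forall n m : nat, {set 'I_n};
  wpi : forall n m, {i : 'I_n | i \in wO n m} -> 'I_m
}.

Section Admissible.
Variables (P : target_pair) (W : exchange_witness).
Local Notation x := (@wx W _).
Local Notation z := (@wz W _).
Local Notation F := (wF W).
Local Notation O := (wO W).

Definition family_ok : Prop :=
  forall n, vertex (Hw P) n ->
    [/\ set0 \in F n,
        forall S T : {set 'I_n}, S \in F n -> T \subset S -> T \in F n
      & forall i : 'I_n, ([set i] \in F n) = wshort W i].

Definition EC1 : Prop :=
  forall n, vertex (Hw P) n ->
    [/\ forall i : 'I_n, 0 <= x i <= Hw P 1%N,
        forall i : 'I_n, wshort W i -> x i <= rho1 P,
        \sum_(i < n) x i = Hw P n,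
        forall S : {set 'I_n}, \sum_(i in S) x i <= Hbar (Hw P) #|S|
      & forall S : {set 'I_n}, S \in F n ->
          \sum_(i in S) x i <= Hbar (Hr P) #|S|].

Definition EC2 : Prop :=
  forall m, vertex (Hr P) m ->
    [/\ forall j : 'I_m, 0 <= z j <= rho1 P,
        \sum_(j < m) z j = Hr P m
      & forall S : {set 'I_m}, \sum_(j in S) z j <= Hbar (Hr P) #|S|].

Definition EC3 : Prop :=
  forall n m, vertex (Hw P) n -> vertex (Hr P) m ->
    [/\ O n m \in F n,
        injective (@wpi W n m),
        forall i : 'I_n, i \in O n m -> wshort W i
      & forall i : {i : 'I_n | i \in O n m}, x (val i) = z (wpi i)].

Definition EC4 : Prop :=
  forall n m, vertex (Hw P) n -> vertex (Hr P) m ->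
    forall i : 'I_n, ~~ wshort W i ->
      Hbar (Hw P) (n.-1 + m - #|O n m|) >=
        Hw P n - x i + Hr P m
        - \sum_(i' : {i' : 'I_n | i' \in O n m}) z (wpi i').

Definition EC5 : Prop :=
  forall n m, vertex (Hw P) n -> vertex (Hr P) m ->
    forall i i' y : 'I_n, i != i' -> [set i; i'] \notin F n ->
      y \notin [set i; i'] :|: O n m ->
      Hbar (Hw P) m.+1 >= x y + Hr P m.

Definition admissible : Prop :=
  [/\ family_ok, EC1, EC2, EC3 & EC4 /\ EC5].

End Admissible.

Definition exchange_closure (P : target_pair) : Prop :=
  dominance P /\ exists W : exchange_witness, admissible P W.

Record full_witness_data := FullWitnessData {
  ground : finType;
  va : ground -> rat;
  sd : ground -> rat;
  capR : rat;
  capD : rat;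
  fX : nat -> {set ground};
  fZ : nat -> {set ground}
}.

Definition full_witness (P : target_pair) (W : full_witness_data) : Prop :=
  let G (S : {set ground W}) := \sum_(i in S) va i in
  let d (S : {set ground W}) := \sum_(i in S) sd i in
  [/\ (#|ground W| <= Nstar P)%N /\ 0 <= capR W < capD W,
      forall i : ground W, 0 <= va i /\ 0 < sd i,
      forall n, vertex (Hw P) n ->
        [/\ #|fX W n| = n, G (fX W n) = Hw P n & d (fX W n) <= capD W],
      forall m, vertex (Hr P) m ->
        [/\ #|fZ W m| = m, G (fZ W m) = Hr P m & d (fZ W m) <= capR W]
    & forall S : {set ground W},
        (d S <= capD W -> G S <= Hbar (Hw P) #|S|) /\
        (d S <= capR W -> G S <= Hbar (Hr P) #|S|)].

Definition full_witness_closure (P : target_pair) : Prop :=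
  exists W : full_witness_data, full_witness P W.

(* Main.v *)
Require Import Defs.
From mathcomp Require Import all_boot all_order all_algebra.
From mathcomp Require Import zify lra.

Set Implicit Arguments.
Unset Strict Implicit.
Unset Printing Implicit Defensive.

Import Order.TTheory GRing.Theory Num.Theory.
Local Open Scope ring_scope.

(** The two inclusions do not depend on the value 3 of [top Hw], and one small
    pair separates the closures.

    A full witness is a knapsack instance in which [capR < capD] are two budgets.
    Restricting it to the sets [fX n] and [fZ m] gives an exchange witness
    ([full_witness_closure_exchange]): an item is short when it fits in the small
    budget, a set of items is in the family when it fits there, and the overlap
    is the true intersection of [fX n] and [fZ m]. The exchange inequalities are
    then the large-budget bound on two sets. Replacing a long item of [fX n] by
    all of [fZ m] does not raise the size, as the long item is larger than
    [capR]. Likewise, if some pair in [fX n] is larger than [capR] and [y] is a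
    third item of [fX n], then [y] together with [fZ m] still fits in [capD].

    From an exchange witness the linear inequalities follow by averaging the
    exchange inequalities over the members of [X_n] that may be exchanged
    ([steep_exchange], [steep_single_exchange], [gap_exchange]). This gives them
    at the vertices of [Hr] only; between vertices [Hr] is linear while the other
    side is concave, so they persist ([le_concave_of_vertex]).

    The separation uses that the last linear inequality has a minimum on its
    right-hand side, whose two terms come from an empty overlap and from an overlap
    with a single member. For the empty overlap the averaging is exact only if
    all the values are equal, and then an average above [rho1] makes every member
    long, which is a case where the other exchange inequality bites. In
    [gap_pair], with [Hw = (0, 5, 7, 9)] and [Hr = (0, 2, 3, 4, 5, 6)], the
    average is 3 and [rho1 = 2]. The linear inequalities hold, with equality in
    the minimum at [m = 5]. In a witness, [X_3] has no pair in
    the family because a pair has total at least 9 - 5 > 3, so the overlap with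
    [Z_5] has at most one member, and members outside it have value at most
    9 - 6 = 3. One member in the overlap is short, of value at most 2, which
    leaves a total of at most 8 < 9. With an empty overlap all values are 3,
    hence long, and exchanging one for [Z_5] would give 9 - 3 + 6 > 9. *)

(** * Concave sequences *)

Definition concave (g : nat -> rat) : Prop :=
  forall k, g k.+2 - g k.+1 <= g k.+1 - g k.

Lemma concave_le_linear (g : nat -> rat) n :
  concave g -> g 0%N = 0 -> g n <= n%:R * g 1%N.
Proof.
move=> cg g0.
have step k : g k.+1 - g k <= g 1%N.
  elim: k => [|k IHk]; first by rewrite g0 subr0.
  exact: le_trans (cg k) IHk.
elim: n => [|n IHn]; first by rewrite g0 mul0r.
by have := step n; rewrite -natr1 mulrDl mul1r; lra.
Qed.

Lemma concave_last_step (g : nat -> rat) n :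
  concave g -> g 0%N = 0 -> n%:R * (g n.+1 - g n) <= g n.
Proof.
move=> cg g0; elim: n => [|n IHn]; first by rewrite mul0r g0.
have := ler_wpM2l (ler0n rat n.+1) (cg n).
by rewrite -natr1; lra.
Qed.

Lemma HbarE (H : target_seq) k : (k <= top H)%N -> Hbar H k = H k.
Proof. by move=> le_kt; rewrite /Hbar (minn_idPl le_kt). Qed.

Lemma Hbar0 (H : target_seq) : Hbar H 0 = 0.
Proof. by rewrite HbarE // seqval0. Qed.

Lemma Hbar_concave (H : target_seq) : concave (Hbar H).
Proof.
move=> k; rewrite /Hbar; case: (leqP k.+2 (top H)) => [lt_kt|lt_tk].
  rewrite !(minn_idPl _); try lia.
  exact: (@seqval_concave H k.+1).
have [eq_kt|neq_kt] := eqVneq (top H) k.+1.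
  have [-> ->] : minn k.+1 (top H) = k.+1 /\ minn k (top H) = k by split; lia.
  by rewrite eq_kt subrr subr_ge0 ltW // seqval_incr // eq_kt.
by rewrite !(minn_idPr _) ?subrr //; lia.
Qed.

Lemma Hbar1_rho1 (P : target_pair) : Hbar (Hr P) 1 = rho1 P.
Proof.
rewrite /rho1; case: eqP => [t0|/eqP]; first by rewrite /Hbar t0 minn0 seqval0.
by rewrite -lt0n => t_gt0; rewrite HbarE // /slope seqval0 subr0.
Qed.

(** At a non-vertex [H] is locally linear, so the difference [g - H] is concave
    there. Hence once [g - H] becomes negative it keeps decreasing until a
    vertex, at the latest [top H], where it would still be negative. *)
Lemma le_concave_of_vertex (H : target_seq) (g : nat -> rat) :
  concave g -> 0 <= g 0%N -> (forall m, vertex H m -> H m <= g m) ->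
  forall m, (m <= top H)%N -> H m <= g m.
Proof.
move=> cg g0 gv.
have fall k : (k < top H)%N -> g k.+1 < H k.+1 ->
    g k.+1 - H k.+1 < g k - H k -> False.
  move En: (top H - k)%N => n.
  elim: n k En => [|n IHn] k En lt_kt ltg ltd; first by lia.
  have nv : ~~ vertex H k.+1 by apply/negP => /gv; lra.
  move: nv; rewrite /vertex ltnS leq0n lt_kt /= negb_or negbK.
  move=> /andP[neq_kt /eqP eq_slope].
  have := cg k; rewrite /slope /= in eq_slope => cgk.
  apply: (IHn k.+1); [lia | by rewrite ltn_neqAle neq_kt | lra | lra].
elim=> [|m IHm] le_mt; first by rewrite seqval0.
rewrite leNgt; apply/negP => ltg; apply: (fall m) => //.
by have := IHm (ltnW le_mt); lra.
Qed.

(** * Finite sums *)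

Lemma sum_le_card (T : finType) (A : {set T}) (f : T -> rat) c :
  (forall i, i \in A -> f i <= c) -> \sum_(i in A) f i <= #|A|%:R * c.
Proof.
move=> fc; apply: le_trans (ler_sum _ fc) _.
by rewrite sumr_const mulr_natl.
Qed.

Lemma sum_setC (T : finType) (A : {set T}) (f : T -> rat) :
  \sum_(i in ~: A) f i = \sum_i f i - \sum_(i in A) f i.
Proof.
rewrite [X in _ = X - _](bigID (mem A)) /= addrC addrK.
by apply: eq_bigl => i; rewrite inE.
Qed.

Lemma sum_setU (T : finType) (A B : {set T}) (f : T -> rat) :
  \sum_(i in A :|: B) f i =
  \sum_(i in A) f i + \sum_(i in B) f i - \sum_(i in A :&: B) f i.
Proof.
rewrite (big_setID A) /= setUK setDUl setDv set0U.
by rewrite [\sum_(i in B) _](big_setID A) /= [B :&: A]setIC; lra.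
Qed.

Lemma sum_set2 (T : finType) (f : T -> rat) i j :
  i != j -> \sum_(k in [set i; j]) f k = f i + f j.
Proof. by move=> neq_ij; rewrite big_setU1 ?inE //= big_set1. Qed.

Lemma sum_sig (T : finType) (A : {set T}) (f : T -> rat) :
  \sum_(u : {i | i \in A}) f (val u) = \sum_(i in A) f i.
Proof.
have [A0|/set0Pn[a aA]] := eqVneq A set0.
  rewrite A0 [RHS]big_set0 big1 // => -[i iA] _.
  by exfalso; rewrite inE in iA.
rewrite [RHS](reindex_onto (val : {i | i \in A} -> T) (insubd (exist _ a aA))) /=.
  by apply: eq_bigl => u; rewrite (valP u) valKd eqxx.
by move=> i iA; rewrite insubdK.
Qed.

(** * From exchange witnesses to linear inequalities *)

Section ExchangeToLinear.
Variables (P : target_pair) (W : exchange_witness).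
Hypothesis adm : admissible P W.
Variable n : nat.
Hypothesis vn : vertex (Hw P) n.
Local Notation x := (@wx W n).
Local Notation short := (@wshort W n).
Local Notation F := (wF W n).
Local Notation rho := (rho1 P).

Let n_gt0 : (0 < n)%N. Proof. by case/andP: vn => /andP[]. Qed.
Let n_top : (n <= top (Hw P))%N. Proof. by case/andP: vn => /andP[]. Qed.

(** The other [n - 1] members carry at most [Hw (n - 1)], so each member has
    value at least the last slope. *)
Lemma long_of_steep i : rho < slope (Hw P) n -> ~~ short i.
Proof.
case: adm => _ /(_ _ vn)[_ xs sx subw _] _ _ _ steep.
apply/negP => /xs x_le.
have := subw (~: [set i]).
rewrite sum_setC big_set1 sx cardsC1 card_ord HbarE; last by lia.
by rewrite /slope in steep; lra.
Qed.

Lemma family_of_long S : (forall i, ~~ short i) -> S \in F -> S = set0.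
Proof.
case: adm => /(_ _ vn)[_ down sing] _ _ _ _ long SF.
apply/eqP; apply: contraT => /set0Pn[i iS].
have := long i; rewrite -sing (down S) //.
by rewrite sub1set.
Qed.

(** The other [n - 2] members have value at most [Hw 1] each, which leaves too
    much on any pair for it to obey the bound on family sets. *)
Lemma pair_notin_family i i' : i != i' ->
  Hbar (Hr P) 2 < Hw P n - (n - 2)%:R * Hw P 1%N -> [set i; i'] \notin F.
Proof.
case: adm => _ /(_ _ vn)[x_le _ sx _ subr] _ _ _ neq_ii' gap.
apply/negP => /subr; rewrite cards2 neq_ii' /=.
have := @sum_le_card _ (~: [set i; i']) x (Hw P 1%N).
rewrite cardsCs setCK cards2 neq_ii' card_ord /= sum_setC sx.
by move=> /(_ (fun j _ => proj2 (andP (x_le j)))); lra.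
Qed.

Variable m : nat.
Hypothesis vm : vertex (Hr P) m.
Local Notation O := (wO W n m).

Lemma overlap_small :
  (forall i i', i != i' -> [set i; i'] \notin F) -> (#|O| <= 1)%N.
Proof.
case: adm => /(_ _ vn)[_ down _] _ _ /(_ _ _ vn vm)[OF _ _ _] _ nopair.
apply/card_le1_eqP => i i' iO i'O; apply/eqP; apply: contraT => /nopair.
by rewrite (down O) // subUset !sub1set iO i'O.
Qed.

(** When no pair is in the family, every member [y] is left out of some pair
    (this needs a third member), so the single-item exchange bounds all the
    members outside the overlap alike. *)
Lemma member_outside_overlap y : (3 <= n)%N ->
  (forall i i', i != i' -> [set i; i'] \notin F) -> y \notin O ->
  x y <= Hbar (Hw P) m.+1 - Hr P m.
Proof.
case: adm => _ _ _ _ [_ /(_ _ _ vn vm) ec5] n_ge3 nopair yO.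
have /card_gt1P[i [i' [iy i'y neq_ii']]] : (1 < #|~: [set y]|)%N.
  by rewrite cardsC1 card_ord; lia.
have := ec5 i i' y neq_ii' (nopair _ _ neq_ii').
rewrite !inE in iy i'y *.
by rewrite (negPf yO) ![y == _]eq_sym (negPf iy) (negPf i'y) /=; lra.
Qed.

(** All members are long and the overlap is empty, so any member may be replaced
    by [Z_m]; the average over the [n] choices is the claim. *)
Lemma steep_exchange : rho < slope (Hw P) n ->
  n.-1%:R / n%:R * Hw P n + Hr P m <= Hbar (Hw P) (n.-1 + m).
Proof.
move=> steep; have long i := long_of_steep i steep.
case: adm => _ /(_ _ vn)[_ _ sx _ _] _ /(_ _ _ vn vm)[OF _ _ _] [ec4 _].
have O0 := family_of_long long OF.
have ge_avg i : Hw P n + Hr P m - Hbar (Hw P) (n.-1 + m) <= x i.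
  have := ec4 _ _ vn vm i (long i).
  rewrite big1; last by move=> [j jO]; exfalso; rewrite O0 inE in jO.
  by rewrite O0 cards0 subn0; lra.
have : \sum_(i in [set: 'I_n]) - x i <=
    #|[set: 'I_n]|%:R * (Hbar (Hw P) (n.-1 + m) - Hw P n - Hr P m).
  by apply: sum_le_card => i _; have := ge_avg i; lra.
rewrite cardsT card_ord sumrN (eq_bigl xpredT) => [|i]; last by rewrite inE.
rewrite sx.
have n_gt0' : 0 < n%:R :> rat by rewrite ltr0n.
have nE : n%:R = n.-1%:R + 1 :> rat by rewrite natr1 prednK.
move=> le; rewrite -lerBrDr mulrAC ler_pdivrMr //.
by rewrite nE in le *; lra.
Qed.

(** All members are bounded by the same quantity, hence so is their average. *)
Lemma steep_single_exchange : rho < slope (Hw P) n -> (3 <= n)%N ->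
  n%:R^-1 * Hw P n + Hr P m <= Hbar (Hw P) m.+1.
Proof.
move=> steep n_ge3; have long i := long_of_steep i steep.
case: adm => _ /(_ _ vn)[_ _ sx _ _] _ /(_ _ _ vn vm)[OF _ _ _] _.
have O0 := family_of_long long OF.
have nopair i i' : i != i' -> [set i; i'] \notin F.
  move=> _; apply/negP => /(family_of_long long)/setP/(_ i).
  by rewrite !inE eqxx.
have : \sum_(y in ~: O) x y <= #|~: O|%:R * (Hbar (Hw P) m.+1 - Hr P m).
  by apply: sum_le_card => y _; apply: member_outside_overlap; rewrite // O0 inE.
rewrite sum_setC sx O0 big_set0 subr0 setC0 cardsT card_ord => le.
by rewrite -lerBrDr mulrC ler_pdivrMr ?ltr0n // mulrC.
Qed.

(** The two terms of the minimum are the average over all members, when the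
    overlap is empty, and the average over the members other than the one
    overlapping member, whose value is at most [rho1] since it is short. *)
Lemma gap_exchange : (3 <= n)%N ->
  Hbar (Hr P) 2 < Hw P n - (n - 2)%:R * Hw P 1%N ->
  Hr P m + Num.min (Hw P n / n%:R) ((Hw P n - rho) / n.-1%:R)
    <= Hbar (Hw P) m.+1.
Proof.
move=> n_ge3 gap.
have nopair i i' neq_ii' := @pair_notin_family i i' neq_ii' gap.
case: adm => _ /(_ _ vn)[_ xs sx _ _] _ /(_ _ _ vn vm)[_ _ Os _] _.
have : \sum_(y in ~: O) x y <= #|~: O|%:R * (Hbar (Hw P) m.+1 - Hr P m).
  by apply: sum_le_card => y; rewrite inE; exact: member_outside_overlap.
rewrite sum_setC sx cardsCs setCK card_ord => le.
rewrite -lerBrDl ge_min; move: le.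
have := overlap_small nopair; rewrite leq_eqVlt ltnS leqn0 => /orP[|].
  move=> /cards1P[o EO]; rewrite EO big_set1 cards1 subn1 => le.
  have /xs x_le : short o by apply: Os; rewrite EO inE.
  apply/orP; right; rewrite ler_pdivrMr ?ltr0n; last by lia.
  by lra.
rewrite cards_eq0 => /eqP->; rewrite big_set0 cards0 subn0 subr0 => le.
by apply/orP; left; rewrite ler_pdivrMr ?ltr0n //; lra.
Qed.

End ExchangeToLinear.

Lemma exchange_closure_linear (P : target_pair) :
  exchange_closure P -> linear_closure P.
Proof.
case=> dom [W adm]; split=> // m le_mt.
(* Reduction of an inequality at all [m] to [m = 0] and the vertices. *)
have extend c C : C <= Hbar (Hw P) c ->
    (forall k, vertex (Hr P) k -> C + Hr P k <= Hbar (Hw P) (c + k)) ->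
    C + Hr P m <= Hbar (Hw P) (c + m).
  move=> C0 Cv; rewrite -lerBrDl.
  apply: (@le_concave_of_vertex _ (fun k => Hbar (Hw P) (c + k) - C)) => //.
  - by move=> k; have := Hbar_concave (Hw P) (c + k); rewrite !addnS; lra.
  - by rewrite addn0 subr_ge0.
  - by move=> k /Cv; lra.
have avg n : vertex (Hw P) n -> Hw P n / n%:R <= Hbar (Hw P) 1.
  move=> /andP[/andP[n_gt0 n_top] _]; rewrite ler_pdivrMr ?ltr0n //.
  rewrite -(HbarE n_top) mulrC.
  exact: concave_le_linear (@Hbar_concave _) (Hbar0 _).
split=> n vn.
- move=> steep; apply: extend => [|k vk]; last exact: (steep_exchange adm).
  case/andP: vn => /andP[n_gt0 n_top] _.
  have := concave_last_step n.-1 (@Hbar_concave (Hw P)) (Hbar0 _).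
  have nE : n%:R = n.-1%:R + 1 :> rat by rewrite natr1 prednK.
  rewrite mulrAC ler_pdivrMr ?ltr0n // prednK // (HbarE n_top) nE; lra.
- move=> steep n_ge3; apply: (extend 1) => [|k vk].
    by rewrite mulrC avg.
  exact: (steep_single_exchange adm).
- move=> n_ge3 gap; rewrite addrC; apply: (extend 1) => [|k vk].
    by rewrite ge_min avg.
  by rewrite addrC; exact: (gap_exchange adm).
Qed.

(** * From full witnesses to exchange witnesses *)

Section Members.
Variables (T : finType) (e0 : T) (A : {set T}) (n : nat).
Hypothesis cardA : #|A| = n.

Definition member (i : 'I_n) : T := nth e0 (enum A) i.

Lemma member_inj : injective member.
Proof.
move=> i j /eqP; rewrite nth_uniq ?enum_uniq -?cardE ?cardA //.
by move=> /eqP/val_inj.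
Qed.

Lemma member_in i : member i \in A.
Proof. by rewrite -mem_enum mem_nth // -cardE cardA. Qed.

Lemma member_image : [set member i | i in [set: 'I_n]] = A.
Proof.
apply/eqP; rewrite eqEcard card_imset; last exact: member_inj.
rewrite cardsT card_ord cardA leqnn andbT.
by apply/subsetP => _ /imsetP[i _ ->]; exact: member_in.
Qed.

Lemma sum_member (S : {set 'I_n}) (f : T -> rat) :
  \sum_(i in S) f (member i) = \sum_(e in member @: S) f e.
Proof. by rewrite big_imset //; move=> i j _ _; exact: member_inj. Qed.

Lemma sum_members (f : T -> rat) :
  \sum_(i < n) f (member i) = \sum_(e in A) f e.
Proof.
rewrite -[in RHS]member_image -sum_member.
by apply: eq_bigl => i; rewrite inE.
Qed.

Lemma member_subset (S : {set 'I_n}) : member @: S \subset A.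
Proof. by apply/subsetP => _ /imsetP[i _ ->]; exact: member_in. Qed.

End Members.

Section FullToExchange.
Variables (P : target_pair) (W : full_witness_data) (e0 : ground W).
Hypothesis Hw_top : (0 < top (Hw P))%N.
Hypothesis fw : full_witness P W.
Local Notation R := (capR W).
Local Notation D := (capD W).
Local Notation item n := (@member _ e0 (fX W n) n).
Local Notation zitem m := (@member _ e0 (fZ W m) m).

(** At vertices this is membership of the item in [fZ m], see [mem_overlap].
    Stated with an index bound it yields the partner in ['I_m] also where
    [fZ m] does not have [m] elements. *)
Definition overlap n m : {set 'I_n} :=
  [set i : 'I_n | (index (item n i) (enum (fZ W m)) < m)%N].

Lemma overlap_index n m (u : {i : 'I_n | i \in overlap n m}) :
  (index (item n (val u)) (enum (fZ W m)) < m)%N.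
Proof. by case: u => i iO /=; rewrite inE in iO. Qed.

Definition exchange_of_full : exchange_witness :=
  @ExchangeWitness
    (fun n i => va (item n i))
    (fun n i => sd (item n i) <= R)
    (fun n => [set S : {set 'I_n} | \sum_(i in S) sd (item n i) <= R])
    (fun m j => va (zitem m j))
    overlap
    (fun n m u => Ordinal (overlap_index u)).
Local Notation V := exchange_of_full.

Let R_ge0 : 0 <= R. Proof. by case: fw => -[_ /andP[]]. Qed.
Let R_lt_D : R < D. Proof. by case: fw => -[_ /andP[]]. Qed.
Let va_ge0 e : 0 <= va (f := W) e. Proof. by case: fw => _ /(_ e)[]. Qed.
Let sd_gt0 e : 0 < sd (f := W) e. Proof. by case: fw => _ /(_ e)[]. Qed.
Let capw (S : {set ground W}) :
  \sum_(i in S) sd i <= D -> \sum_(i in S) va i <= Hbar (Hw P) #|S|.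
Proof. by case: fw => _ _ _ _ /(_ S)[]. Qed.
Let capr (S : {set ground W}) :
  \sum_(i in S) sd i <= R -> \sum_(i in S) va i <= Hbar (Hr P) #|S|.
Proof. by case: fw => _ _ _ _ /(_ S)[]. Qed.
Let xcard n : vertex (Hw P) n -> #|fX W n| = n.
Proof. by case: fw => _ _ /(_ n) X _ _ /X[]. Qed.
Let zcard m : vertex (Hr P) m -> #|fZ W m| = m.
Proof. by case: fw => _ _ _ /(_ m) Z _ /Z[]. Qed.
Let xval n : vertex (Hw P) n -> \sum_(e in fX W n) va e = Hw P n.
Proof. by case: fw => _ _ /(_ n) X _ _ /X[]. Qed.
Let zval m : vertex (Hr P) m -> \sum_(e in fZ W m) va e = Hr P m.
Proof. by case: fw => _ _ _ /(_ m) Z _ /Z[]. Qed.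
Let xsize n : vertex (Hw P) n -> \sum_(e in fX W n) sd e <= D.
Proof. by case: fw => _ _ /(_ n) X _ _ /X[]. Qed.
Let zsize m : vertex (Hr P) m -> \sum_(e in fZ W m) sd e <= R.
Proof. by case: fw => _ _ _ /(_ m) Z _ /Z[]. Qed.

Lemma size_subset (A B : {set ground W}) :
  A \subset B -> \sum_(e in A) sd e <= \sum_(e in B) sd e.
Proof.
move=> /setIidPr sAB; rewrite [leRHS](big_setID A) /= sAB lerDl.
by apply: sumr_ge0 => e _; exact: ltW.
Qed.

Lemma capw1 e : sd e <= D -> va (f := W) e <= Hbar (Hw P) 1.
Proof. by have := @capw [set e]; rewrite cards1 !big_set1. Qed.

Lemma capr1 e : sd e <= R -> va (f := W) e <= Hbar (Hr P) 1.
Proof. by have := @capr [set e]; rewrite cards1 !big_set1. Qed.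

Lemma size_member (A : {set ground W}) e :
  e \in A -> sd e <= \sum_(i in A) sd i.
Proof. by rewrite -sub1set => /size_subset; rewrite big_set1. Qed.

Lemma full_dominance : dominance P.
Proof.
apply: le_concave_of_vertex; first exact: Hbar_concave.
  by rewrite Hbar0.
move=> m vm; rewrite -zval // -[in leRHS](zcard vm) capw //.
exact: le_trans (zsize vm) (ltW R_lt_D).
Qed.

Lemma mem_overlap n m i : vertex (Hr P) m ->
  (i \in overlap n m) = (item n i \in fZ W m).
Proof. by move=> vm; rewrite inE -{2}(zcard vm) cardE index_mem mem_enum. Qed.

Lemma overlap_image n m : vertex (Hw P) n -> vertex (Hr P) m ->
  item n @: overlap n m = fX W n :&: fZ W m.
Proof.
move=> vn vm; apply/setP => e; apply/imsetP/setIP => [[i]|[eX eZ]].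
  by rewrite mem_overlap // => iZ ->; rewrite (member_in e0 (xcard vn)).
move: eX; rewrite -{1}(member_image e0 (xcard vn)) => /imsetP[i _ Ei].
by exists i; rewrite // mem_overlap // -Ei.
Qed.

Lemma overlap_value n m (u : {i : 'I_n | i \in overlap n m}) :
  vertex (Hr P) m -> zitem m (Ordinal (overlap_index u)) = item n (val u).
Proof.
move=> vm; rewrite /member /= nth_index // mem_enum.
by rewrite -(mem_overlap _ vm) (valP u).
Qed.

Lemma full_family_ok : family_ok P V.
Proof.
move=> n vn; split=> [|S T|i]; rewrite !inE.
- by rewrite big_set0.
- move=> SR sTS.
  rewrite !(sum_member e0 (xcard vn)) in SR *.
  exact: le_trans (size_subset (imsetS _ sTS)) SR.
- by rewrite big_set1.
Qed.

Lemma full_EC1 : EC1 P V.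
Proof.
move=> n vn.
have sub S := le_trans (size_subset (member_subset e0 (xcard vn) S)) (xsize vn).
have card (S : {set 'I_n}) : #|item n @: S| = #|S|.
  by rewrite card_imset //; exact: member_inj (xcard vn).
split=> [i|i iR||S|S] /=.
- rewrite va_ge0 -(HbarE Hw_top) capw1 //.
  exact: le_trans (size_member (member_in e0 (xcard vn) i)) (xsize vn).
- by rewrite -Hbar1_rho1 capr1.
- by rewrite (sum_members e0 (xcard vn)) xval.
- by rewrite (sum_member e0 (xcard vn)) -card capw.
- rewrite inE !(sum_member e0 (xcard vn)) -card; exact: capr.
Qed.

Lemma full_EC2 : EC2 P V.
Proof.
move=> m vm.
have sub S := le_trans (size_subset (member_subset e0 (zcard vm) S)) (zsize vm).
have card (S : {set 'I_m}) : #|zitem m @: S| = #|S|.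
  by rewrite card_imset //; exact: member_inj (zcard vm).
split=> [j||S] /=.
- rewrite va_ge0 -Hbar1_rho1 capr1 //.
  exact: le_trans (size_member (member_in e0 (zcard vm) j)) (zsize vm).
- by rewrite (sum_members e0 (zcard vm)) zval.
- by rewrite (sum_member e0 (zcard vm)) -card capr.
Qed.

Lemma full_EC3 : EC3 P V.
Proof.
move=> n m vn vm.
have OR : \sum_(i in overlap n m) sd (item n i) <= R.
  rewrite (sum_member e0 (xcard vn)) overlap_image //.
  exact: le_trans (size_subset (subsetIr _ _)) (zsize vm).
split=> [|u v /(congr1 (zitem m))|i iO|u] /=.
- by rewrite inE.
- by rewrite !overlap_value // => /(member_inj (xcard vn))/val_inj.
- apply: le_trans (zsize vm); apply: size_member.
  by rewrite -mem_overlap.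
- by rewrite overlap_value.
Qed.

Lemma long_notin_small m n i : vertex (Hr P) m ->
  R < sd (item n i) -> item n i \notin fZ W m.
Proof.
move=> vm long; apply/negP => iZ.
by have := le_trans (size_member iZ) (zsize vm); rewrite leNgt long.
Qed.

Lemma full_EC4 : EC4 P V.
Proof.
move=> n m vn vm i /=; rewrite -ltNge => long.
have iX := member_in e0 (xcard vn) i.
have iZ := long_notin_small vm long.
(* A long item is not in [fZ m], so removing it leaves the overlap unchanged. *)
have XDI : (fX W n :\ item n i) :&: fZ W m = item n @: overlap n m.
  rewrite overlap_image //; apply/setP => e; rewrite !inE.
  by have [->|] := eqVneq e (item n i); rewrite ?(negPf iZ) ?andbF.
have Osum : \sum_(u : {i | i \in overlap n m})
    va (zitem m (Ordinal (overlap_index u))) =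
    \sum_(e in item n @: overlap n m) va e.
  rewrite -(sum_member e0 (xcard vn)) -(sum_sig _ (fun i => va (item n i))).
  by apply: eq_bigr => u _; rewrite overlap_value.
have DX (f : ground W -> rat) : \sum_(e in fX W n :\ item n i) f e =
    \sum_(e in fX W n) f e - f (item n i).
  by rewrite (big_setD1 _ iX) /= addrC addrK.
have := @capw (fX W n :\ item n i :|: fZ W m).
rewrite cardsU XDI (card_imset _ (member_inj (xcard vn))).
have -> : #|fX W n :\ item n i| = n.-1.
  by have := cardsD1 (item n i) (fX W n); rewrite iX (xcard vn); lia.
rewrite zcard // !sum_setU XDI !DX xval // zval // Osum => -> //.
have Isize : 0 <= \sum_(e in item n @: overlap n m) sd (f := W) e.
  by apply: sumr_ge0 => e _; exact: ltW.
by have := xsize vn; have := zsize vm; lra.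
Qed.

Lemma full_EC5 : EC5 P V.
Proof.
move=> n m vn vm i i' y neq_ii'; rewrite !inE -ltNge sum_set2 // => big_pair.
rewrite !negb_or => /andP[/andP[yi yi'] yO] /=.
have yX := member_in e0 (xcard vn) y.
have yZ : item n y \notin fZ W m by rewrite -mem_overlap // inE.
have tripleX : sd (item n i) + sd (item n i') + sd (item n y) <= D.
  have := size_subset (member_subset e0 (xcard vn) (y |: [set i; i'])).
  rewrite -(sum_member e0 (xcard vn)) big_setU1 ?inE ?negb_or ?yi //=.
  by rewrite sum_set2 //; have := xsize vn; lra.
have := @capw (item n y |: fZ W m).
rewrite cardsU1 yZ zcard // !big_setU1 //= zval // => -> //.
by have := zsize vm; lra.
Qed.

End FullToExchange.

Lemma full_witness_closure_exchange (P : target_pair) :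
  (0 < top (Hw P))%N -> full_witness_closure P -> exchange_closure P.
Proof.
move=> Hw_top [W fw]; split; first exact: full_dominance fw.
have vtop : vertex (Hw P) (top (Hw P)) by rewrite /vertex Hw_top leqnn eqxx.
have /card_gt0P[e0 _] : (0 < #|fX W (top (Hw P))|)%N.
  by case: fw => _ _ /(_ _ vtop)[-> _ _] _ _.
exists (exchange_of_full e0); split; last (split).
- exact: full_family_ok.
- exact: full_EC1.
- exact: full_EC2.
- exact: full_EC3.
- exact: full_EC4.
- exact: full_EC5.
Qed.

(** * A pair in the linear closure outside the exchange closure *)

Section Ramp.
Variables (a b t : nat).
Hypothesis b_gt0 : (0 < b)%N.

(** Slopes [a + b, b, b, ...]: only 1 and the last index can be vertices. *)
Definition ramp_val (k : nat) : rat := (if k is 0 then 0 else a + b * k)%:R.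

Lemma ramp_incr k : (k < t)%N -> ramp_val k < ramp_val k.+1.
Proof. by move=> _; rewrite ltr_nat; case: k => [|k]; lia. Qed.

Lemma ramp_concave k : (0 < k < t)%N ->
  ramp_val k.+1 - ramp_val k <= ramp_val k - ramp_val k.-1.
Proof.
case: k => // k _; rewrite lerBrDr addrAC lerBlDr /ramp_val -!natrD ler_nat.
by case: k => [|k] /=; lia.
Qed.

Definition ramp : target_seq :=
  @TargetSeq t ramp_val erefl ramp_incr ramp_concave.

End Ramp.

Definition gap_pair : target_pair :=
  TargetPair (@ramp 3 2 3 isT) (@ramp 1 1 5 isT).

Lemma gap_pair_vertex n : vertex (Hw gap_pair) n -> n = 1%N \/ n = 3%N.
Proof.
have flat2 : ~~ vertex (Hw gap_pair) 2 by [].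
case: n => [|[|[|[|n]]]] vn; [by [] | by left | | by right | by []].
by rewrite (negPf flat2) in vn.
Qed.

Lemma gap_pair_linear : linear_closure gap_pair.
Proof.
have dom : dominance gap_pair by case=> [|[|[|[|[|[|k]]]]]].
(* Both sides equal 2, so the vertex 3 is not steep. *)
have flat : ~~ (rho1 gap_pair < slope (Hw gap_pair) 3) by [].
have eq3 n : vertex (Hw gap_pair) n -> (3 <= n)%N -> n = 3%N.
  by move=> /gap_pair_vertex[] ->.
split; first exact: dom.
move=> m le_m; split=> n vn.
- case: (gap_pair_vertex vn) => -> steep.
    have -> : 1.-1%:R / 1%:R * Hw gap_pair 1%N = 0 by rewrite !mul0r.
    by rewrite add0r; exact: dom.
  case: (negP flat steep).
- move=> steep /(eq3 _ vn) n3; case: (negP flat); rewrite -n3; exact: steep.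
- move=> /(eq3 _ vn) -> _; apply: le_trans (_ : Hr gap_pair m + 3%:R <= _).
    (* The first term of the minimum, [Hw 3 / 3 = 3], is enough. *)
    rewrite lerD2l ge_min; apply/orP; left.
    by rewrite ler_pdivrMr ?ltr0n // -natrM ler_nat.
  by case: m le_m => [|[|[|[|[|[|m]]]]]] // _; rewrite -natrD ler_nat.
Qed.

Lemma gap_pair_not_exchange : ~ exchange_closure gap_pair.
Proof.
case=> _ [W adm].
have vn : vertex (Hw gap_pair) 3 by [].
have vm : vertex (Hr gap_pair) 5 by [].
have gap : Hbar (Hr gap_pair) 2 < Hw gap_pair 3%N - (3 - 2)%:R * Hw gap_pair 1%N.
  by [].
have w3 : Hw gap_pair 3%N = 9%:R by [].
have w6 : Hbar (Hw gap_pair) 6 = 9%:R by [].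
have r5 : Hr gap_pair 5%N = 6%:R by [].
have rho2 : rho1 gap_pair = 2%:R by [].
have nopair i i' : i != i' -> [set i; i'] \notin wF W 3.
  by move=> neq_ii'; apply: (pair_notin_family adm vn neq_ii'); exact: gap.
have out y : y \notin wO W 3 5 -> wx W y <= 3%:R.
  move=> yO; have := member_outside_overlap adm vn vm isT nopair yO.
  by rewrite w6 r5; lra.
(* Used with [A] a singleton containing the overlap: the two members outside [A]
   total at most 6. *)
have others (A : {set 'I_3}) : wO W 3 5 \subset A ->
    9%:R - \sum_(y in A) wx W y <= (3 - #|A|)%:R * 3%:R.
  case: (adm) => _ /(_ _ vn)[_ _ sx _ _] _ _ _ OA.
  have -> : (3 - #|A|)%N = #|~: A| by have := cardsC A; rewrite card_ord; lia.
  rewrite -w3 -sx -sum_setC.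
  apply: sum_le_card => y; rewrite inE => yA; apply: out.
  by apply: contra yA; exact: (subsetP OA).
case: (adm) => _ /(_ _ vn)[_ xs _ _ _] _ /(_ _ _ vn vm)[_ _ Os _] [ec4 _].
have short_le (i : 'I_3) : wshort W i -> wx W i <= 2%:R by rewrite -rho2; exact: xs.
have := overlap_small adm vn vm nopair; rewrite leq_eqVlt ltnS leqn0 => /orP[|].
  move=> /cards1P[o EO].
  have /short_le x_le : wshort W o by apply: Os; rewrite EO inE.
  have := others [set o]; rewrite EO subxx big_set1 cards1 => /(_ isT).
  by rewrite (_ : (3 - 1)%N = 2%N) //; lra.
rewrite cards_eq0 => /eqP EO.
(* With an empty overlap every member has value 3; [ord0] stands for any. *)
have := others [set ord0]; rewrite EO sub0set big_set1 cards1 => /(_ isT) x_ge.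
have x_le : wx W (ord0 : 'I_3) <= 3%:R by apply: out; rewrite EO inE.
have long : ~~ wshort W (ord0 : 'I_3).
  by apply/negP => /short_le; rewrite (_ : (3 - 1)%N = 2%N) // in x_ge; lra.
have w7 : Hbar (Hw gap_pair) 7 = 9%:R by [].
have := ec4 3 5 vn vm ord0 long.
rewrite big1; last by move=> [j jO]; exfalso; rewrite EO inE in jO.
rewrite EO cards0 (_ : (3.-1 + 5 - 0)%N = 7%N) // w7 w3 r5; lra.
Qed.

Local Close Scope ring_scope.

Theorem corollary4p8 :
  [/\ forall P : target_pair, top (Hw P) = 3 ->
        full_witness_closure P -> exchange_closure P,
      forall P : target_pair, top (Hw P) = 3 ->
        exchange_closure P -> linear_closure P,
      exists P : target_pair,
        [/\ top (Hw P) = 3, linear_closure P & ~ exchange_closure P]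
    & exists P : target_pair,
        [/\ top (Hw P) = 3, linear_closure P & ~ full_witness_closure P]].
Proof.
split=> [P top3|P _||].
- by apply: full_witness_closure_exchange; rewrite top3.
- exact: exchange_closure_linear.
- exists gap_pair; split; first by [].
    exact: gap_pair_linear.
  exact: gap_pair_not_exchange.
- exists gap_pair; split; first by [].
    exact: gap_pair_linear.
  move=> /full_witness_closure_exchange ec.
  by apply: gap_pair_not_exchange; apply: ec.
Qed.
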